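(* Let $R$ be a ring. For any subgroup $S$ of the group $(Q(R),\circ)$ the following are equivalent: (i) $S$ is closed under addition (of $R$); (ii) $S$ is closed under multiplication (of $R$); (iii) $S$ is a subring of $R$.
   Context: Rings are associative, possibly nonunital and noncommutative; subrings need not contain an identity element. On a ring $R$ define $a\circ b=a+b-ab$; $(R,\circ)$ is a monoid with identity $0$. An element $a\in R$ is quasi-regular if it is invertible in $(R,\circ)$, i.e. there is $a'\in R$ with $a\circ a'=a'\circ a=0$. $Q(R)$ denotes the set of quasi-regular elements of $R$; it is a group under $\circ$ with identity $0$. *)

(* Defs.v *)
From HB Require Import structures.
From mathcomp Require Export all_boot ssralg boolp classical_sets.

Set Implicit Arguments.
Unset Strict Implicit.
Unset Printing Implicit Defensive.

Import GRing.Theory.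
Local Open Scope classical_set_scope.
Local Open Scope ring_scope.

(* GRing.PzRing and its descendants all require a multiplicative identity,
   hence this separate structure of associative, possibly nonunital and
   noncommutative, rings. *)
HB.mixin Record Zmodule_isNonUnitalRing R of GRing.Zmodule R := {
  numul : R -> R -> R;
  numulA : associative numul;
  numulDl : left_distributive numul +%R;
  numulDr : right_distributive numul +%R
}.

#[short(type="nonUnitalRingType")]
HB.structure Definition NonUnitalRing :=
  {R of Zmodule_isNonUnitalRing R & GRing.Zmodule R}.

Notation "a ** b" := (numul a b) (at level 40, left associativity) : ring_scope.

Definition circ (R : nonUnitalRingType) (a b : R) : R := a + b - a ** b.

Notation "a \circ b" := (circ a b) (at level 50, left associativity) : ring_scope.

Definition circ_inverse (R : nonUnitalRingType) (a a' : R) : Prop :=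
  a \circ a' = 0 /\ a' \circ a = 0.

Definition quasi_regular (R : nonUnitalRingType) : set R :=
  [set a | exists a', circ_inverse a a'].


(* The inverse in Q(R) is given by the relation circ_inverse, which is
   functional by circ_inverse_unique below. *)
Record is_circ_subgroup (R : nonUnitalRingType) (S : set R) : Prop := {
  circ_subgroup_sub : S `<=` @quasi_regular R;
  circ_subgroup0 : S 0;
  circ_subgroup_circ : forall a b, S a -> S b -> S (a \circ b);
  circ_subgroup_inv : forall a a', S a -> circ_inverse a a' -> S a'
}.

Definition add_closed (R : nonUnitalRingType) (S : set R) : Prop :=
  forall a b, S a -> S b -> S (a + b).

Definition mul_closed (R : nonUnitalRingType) (S : set R) : Prop :=
  forall a b, S a -> S b -> S (a ** b).

Record is_subring (R : nonUnitalRingType) (S : set R) : Prop := {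
  subring0 : S 0;
  subringD : add_closed S;
  subringN : forall a, S a -> S (- a);
  subringM : mul_closed S
}.

Section CircTheory.
Variable R : nonUnitalRingType.
Implicit Types a b c : R.

Lemma numul0r a : 0 ** a = 0.
Proof. by apply: (@addrI _ (0 ** a)); rewrite -numulDl !addr0. Qed.

Lemma numulr0 a : a ** 0 = 0.
Proof. by apply: (@addrI _ (a ** 0)); rewrite -numulDr !addr0. Qed.

Lemma numulNr a b : (- a) ** b = - (a ** b).
Proof. by apply: (@addrI _ (a ** b)); rewrite -numulDl !subrr numul0r. Qed.

Lemma numulrN a b : a ** (- b) = - (a ** b).
Proof. by apply: (@addrI _ (a ** b)); rewrite -numulDr !subrr numulr0. Qed.

Lemma circ0r : left_id (0 : R) (@circ R).
Proof. by move=> a; rewrite /circ numul0r add0r subr0. Qed.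

Lemma circr0 : right_id (0 : R) (@circ R).
Proof. by move=> a; rewrite /circ numulr0 addr0 subr0. Qed.

Lemma circA : associative (@circ R).
Proof.
move=> a b c; rewrite /circ !(numulDl, numulDr, numulNr, numulrN) numulA.
rewrite !opprD !opprK !addrA.
congr (_ + _); rewrite (addrAC (a + b) (- (a ** b)) c).
by rewrite (addrAC _ (- (b ** c)) (- (a ** b))) (addrAC _ (- (b ** c)) (- (a ** c))).
Qed.

Lemma circ_inverse_sym a b : circ_inverse a b -> circ_inverse b a.
Proof. by case. Qed.

Lemma circ_inverse_unique a b c : circ_inverse a b -> circ_inverse a c -> b = c.
Proof. by move=> [_ ba] [ac _]; rewrite -[b]circr0 -ac circA ba circ0r. Qed.

Lemma circ_inverse_circ a a' b b' :
  circ_inverse a a' -> circ_inverse b b' -> circ_inverse (a \circ b) (b' \circ a').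
Proof.
move=> [aa' a'a] [bb' b'b]; split.
  by rewrite circA -(circA a) bb' circr0.
by rewrite circA -(circA b') a'a circr0.
Qed.

Lemma quasi_regular_subgroup : is_circ_subgroup (@quasi_regular R).
Proof.
split=> //.
- by exists 0; split; rewrite circ0r.
- move=> a b [a' aa'] [b' bb']; exists (b' \circ a').
  exact: circ_inverse_circ.
- by move=> a a' _ /circ_inverse_sym ?; exists a.
Qed.

End CircTheory.

(* Main.v *)
(* In a ring with unit, a |-> 1 - a turns \circ into the product, so S
   corresponds to a group G = 1 - S of units.
   If S is closed under addition, so is G under (g, h) |-> g + h - 1; taking
   g = h = x^-1 and multiplying by x puts 2 - x in G, so S is closed under
   opposite, and ab = a + b - a \circ b.
   If S is closed under multiplication, then G is closed under
   (g, h) |-> g + h - gh; multiplying by k on the left, with k = zx,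
   g = x^-1 z^-1 x and h = x^-1, gives x + z - 1 in G, so S is closed under
   addition. *)
Require Import Defs.
Import GRing.Theory.
Local Open Scope classical_set_scope.
Local Open Scope ring_scope.

(** Since [a \circ a' = 0] means [a ** a' = a + a'], the left side is a + 2a' - 2(a + a'). *)
Lemma circ_inverse_oppr (R : nonUnitalRingType) (a a' : R) :
  circ_inverse a a' -> a \circ (a' + a') = - a.
Proof.
case=> aa' _; have aa'E : a ** a' = a + a' by apply/esym/subr0_eq.
rewrite /circ numulDr aa'E addrACA opprD addrACA subrr addr0.
by rewrite opprD addrA subrr add0r.
Qed.

(* \circ has the precedence of +, whence the parentheses. *)
Lemma circ_numulr (R : nonUnitalRingType) (c p q : R) :
  c \circ (p ** q) = (c \circ p) + (c \circ q) - (c \circ p \circ q).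
Proof.
(* Only the outer [\circ] is unfolded, so that [c \circ p] cancels as a whole. *)
have -> : c \circ p \circ q = (c \circ p) + (q - (c \circ p) ** q) by rewrite addrA.
rewrite [X in X - _]addrC addrKA opprB addrCA /circ.
rewrite !(numulDl, numulNr) numulA.
by rewrite [RHS]addrC (addrAC (c + q)) addrK -!addrA addKr.
Qed.

Lemma circ_subgroup_add_subring (R : nonUnitalRingType) (S : set R) :
  is_circ_subgroup S -> add_closed S -> is_subring S.
Proof.
move=> hS SD; have SN a : S a -> S (- a).
  move=> Sa; have [a' aa'] := circ_subgroup_sub hS Sa.
  have Sa' := circ_subgroup_inv hS Sa aa'.
  by rewrite -(circ_inverse_oppr _ _ _ aa'); apply: (circ_subgroup_circ hS) => //; apply: SD.
split=> //; first exact: circ_subgroup0 hS.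
move=> a b Sa Sb; have -> : a ** b = a + b - (a \circ b) by rewrite /circ subKr.
by apply: (SD); [exact: SD | apply/SN/(circ_subgroup_circ hS)].
Qed.

Lemma circ_subgroup_mul_add (R : nonUnitalRingType) (S : set R) :
  is_circ_subgroup S -> mul_closed S -> add_closed S.
Proof.
move=> hS SM a b Sa Sb.
have [a' aa'] := circ_subgroup_sub hS Sa; have Sa' := circ_subgroup_inv hS Sa aa'.
have [b' bb'] := circ_subgroup_sub hS Sb; have Sb' := circ_subgroup_inv hS Sb bb'.
have SC := circ_subgroup_circ hS.
(* In [circ_numulr], take c = [b \circ a], q = a' and p the conjugate of b' by a: then [c \circ p] =
   a, [c \circ q] = b and [c \circ p \circ q] = [a \circ a'] = 0. *)
have -> : a + b = (b \circ a) \circ ((a' \circ b' \circ a) ** a').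
  have baa' : b \circ a \circ a' = b by rewrite -circA aa'.1 circr0.
  by rewrite circ_numulr !circA baa' bb'.1 circ0r aa'.1 subr0.
by apply: (SC); [exact: SC | apply: SM => //; apply: (SC) => //; exact: SC].
Qed.

Theorem theorem4p8 (R : nonUnitalRingType) (S : set R) (hS : is_circ_subgroup S) :
  [<-> add_closed S; mul_closed S; is_subring S].
Proof.
tfae.
- by move=> /(circ_subgroup_add_subring _ _ hS) /subringM.
(* Addition comes first, because opposites are obtained from a' + a'. *)
- by move=> /(circ_subgroup_mul_add _ _ hS) /(circ_subgroup_add_subring _ _ hS).
- exact: subringD.
Qed.
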